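(* Let $F$ be a field of characteristic $p>0$, let $n\geq 2$ be an integer, let $\alpha\in F$ and $\beta,\gamma,\delta_1,\dots,\delta_{n-2}\in F^\times$. Consider the two (separably $(n-1)$-linked) symbols $$\pi=\alpha \frac{d \delta_1}{\delta_1} \wedge \dots \wedge \frac{d \delta_{n-2}}{\delta_{n-2}} \wedge \frac{d \beta}{\beta} \quad\text{and}\quad \omega=\alpha \frac{d \delta_1}{\delta_1} \wedge \dots \wedge \frac{d \delta_{n-2}}{\delta_{n-2}} \wedge \frac{d \gamma}{\gamma}$$ in $H_p^n(F)$. If $\pi$ and $\omega$ are totally separably $1$-linked, then the class of $$\alpha \frac{d \delta_1}{\delta_1} \wedge \dots \wedge \frac{d \delta_{n-2}}{\delta_{n-2}} \wedge \frac{d \beta}{\beta} \wedge \frac{d\gamma}{\gamma}$$ in $H_p^{n+1}(F)$ is trivial.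
   Context: Let $F$ be a field of characteristic $p>0$ and let $\Omega_F^n$ be the $n$-th exterior power of the module of absolute differentials of $F$. For $n>0$, the Kato-Milne cohomology group $H_p^{n+1}(F)$ is the cokernel of the Artin-Schreier map $\wp:\Omega_F^n\to\Omega_F^n/d\Omega_F^{n-1}$ given by $\alpha \frac{d \beta_1}{\beta_1} \wedge \dots \wedge \frac{d \beta_n}{\beta_n} \mapsto (\alpha^p-\alpha) \frac{d \beta_1}{\beta_1} \wedge \dots \wedge \frac{d \beta_n}{\beta_n}$, and $\nu_F(n)$ is the kernel of this map. Also $H_p^1(F)=F/\wp(F)$, where $\wp(a)=a^p-a$ for $a\in F$. A symbol in $H_p^n(F)$ is a class of the form $\alpha \frac{d \beta_1}{\beta_1} \wedge \dots \wedge \frac{d \beta_{n-1}}{\beta_{n-1}}$ ($\alpha\in F$, $\beta_i\in F^\times$); a symbol in $\nu_F(m)$ is an element $\frac{d \gamma_1}{\gamma_1} \wedge \dots \wedge \frac{d \gamma_m}{\gamma_m}$ ($\gamma_i\in F^\times$). The wedge product induces a map $H_p^k(F)\times\nu_F(m)\to H_p^{k+m}(F)$. If a symbol in $H_p^{k+m}(F)$ equals $\theta\wedge\psi$ with $\theta$ a symbol in $H_p^k(F)$ and $\psi$ a symbol in $\nu_F(m)$, then $\theta$ is called a factor in $H_p^k(F)$ of it. Two symbols are separably $k$-linked if they have a common factor in $H_p^k(F)$, and totally separably $k$-linked if they share all factors in $H_p^k(F)$ (a symbol in $H_p^k(F)$ is a factor of one if and only if it is a factor of the other). *)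

(* Defs.v *)
From HB Require Import structures.
From mathcomp Require Import all_boot all_algebra.
From mathcomp Require Import boolp.
From mathcomp Require Import freeg.

Set Implicit Arguments.
Unset Strict Implicit.
Unset Printing Implicit Defensive.

Import GRing.Theory.
Local Open Scope ring_scope.
Local Open Scope quotient_scope.

Inductive zspan (V : zmodType) (G : V -> Prop) : V -> Prop :=
| zspan0 : zspan G 0
| zspan_gen x : G x -> zspan G x
| zspanB x y : zspan G x -> zspan G y -> zspan G (x - y).

Lemma zspanN (V : zmodType) (G : V -> Prop) x : zspan G x -> zspan G (- x).
Proof. by move=> Gx; rewrite -sub0r; apply: zspanB => //; apply: zspan0. Qed.

Lemma zspanD (V : zmodType) (G : V -> Prop) x y :
  zspan G x -> zspan G y -> zspan G (x + y).
Proof. by move=> Gx Gy; rewrite -[y]opprK; apply/zspanB/zspanN. Qed.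

Definition zspan_pred (V : zmodType) (G : V -> Prop) : {pred V} :=
  fun x => `[< zspan G x >].

Fact zspan_pred_zmod_closed (V : zmodType) (G : V -> Prop) :
  zmod_closed (zspan_pred G).
Proof.
split=> [|x y /asboolP Gx /asboolP Gy]; apply/asboolP; first exact: zspan0.
exact: zspanB.
Qed.

HB.instance Definition _ (V : zmodType) (G : V -> Prop) :=
  GRing.isZmodClosed.Build V (zspan_pred G) (zspan_pred_zmod_closed G).

(* V modulo the additive subgroup generated by G *)
Definition zquot (V : zmodType) (G : V -> Prop) : Type :=
  Quotient.quot (zspan_pred G).

HB.instance Definition _ (V : zmodType) (G : V -> Prop) :=
  GRing.Zmodule.on (zquot G).
HB.instance Definition _ (V : zmodType) (G : V -> Prop) :=
  ZmodQuotient.on (zquot G).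

Lemma zquot_eqP (V : zmodType) (G : V -> Prop) (x y : V) :
  \pi_(zquot G) x = \pi_(zquot G) y <-> zspan G (x - y).
Proof.
split=> [/eqP|h]; first by rewrite -Quotient.idealrBE => /asboolP.
by apply/eqP; rewrite -Quotient.idealrBE; apply/asboolP.
Qed.

Section LinearQuotient.
Variables (R : nzRingType) (M : lmodType R) (G : M -> Prop).

Inductive scaled : M -> Prop := Scaled a g : G g -> scaled (a *: g).

(* M modulo the submodule generated by G *)
Definition lquot : Type := zquot scaled.

HB.instance Definition _ := GRing.Zmodule.on lquot.
HB.instance Definition _ := ZmodQuotient.on lquot.

Lemma zspan_scaled a x : zspan scaled x -> zspan scaled (a *: x).
Proof.
elim=> [|y [b g Gg]|y z _ hy _ hz]; first by rewrite scaler0; exact: zspan0.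
  by rewrite scalerA; apply: zspan_gen.
by rewrite scalerBr; apply: zspanB.
Qed.

Definition lquot_scale (a : R) (x : lquot) : lquot := \pi_lquot (a *: repr x).

Lemma lquot_scale_pi a x :
  lquot_scale a (\pi_lquot x) = \pi_lquot (a *: x).
Proof.
apply/zquot_eqP; rewrite -scalerBr; apply: zspan_scaled; apply/zquot_eqP.
by rewrite reprK.
Qed.

Fact lquot_scalerA a b v :
  lquot_scale a (lquot_scale b v) = lquot_scale (a * b) v.
Proof. by elim/quotW: v => x; rewrite (lquot_scale_pi b x) !lquot_scale_pi scalerA. Qed.

Fact lquot_scale1r : left_id 1 lquot_scale.
Proof. by elim/quotW=> x; rewrite lquot_scale_pi scale1r. Qed.

Fact lquot_scalerDr : right_distributive lquot_scale +%R.
Proof.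
move=> a; elim/quotW=> x; elim/quotW=> y.
by rewrite -raddfD !lquot_scale_pi scalerDr raddfD.
Qed.

Fact lquot_scalerDl v : {morph lquot_scale^~ v : a b / a + b}.
Proof.
by elim/quotW: v => x a b; rewrite !lquot_scale_pi scalerDl raddfD.
Qed.

HB.instance Definition _ := GRing.Zmodule_isLmodule.Build R lquot
  lquot_scalerA lquot_scale1r lquot_scalerDr lquot_scalerDl.

End LinearQuotient.

Lemma lquot_pi_linear (R : nzRingType) (M : lmodType R) (G : M -> Prop)
  (a : R) (x y : M) :
  \pi_(lquot G) (a *: x + y) = a *: \pi_(lquot G) x + \pi_(lquot G) y.
Proof. by rewrite raddfD; congr (_ + _); rewrite -[LHS]lquot_scale_pi. Qed.

Section ExteriorPower.
Variables (F : fieldType) (V : lmodType F).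

Definition tuple_set n (t : n.-tuple V) (i : 'I_n) (v : V) : n.-tuple V :=
  [tuple if j == i then v else tnth t j | j < n].

Inductive ext_rel n : {freeg (n.-tuple V) / F} -> Prop :=
| ext_rel_linear t i a u v :
    ext_rel (<< tuple_set t i (a *: u + v) >> - a *: << tuple_set t i u >>
             - << tuple_set t i v >>)
| ext_rel_alt t i j : i != j -> tnth t i = tnth t j -> ext_rel << t >>.

Definition extpow n : Type := lquot (@ext_rel n).

HB.instance Definition _ n := GRing.Lmodule.on (extpow n).
HB.instance Definition _ n := ZmodQuotient.on (extpow n).

(* v_1 /\ ... /\ v_n *)
Definition ext n (t : n.-tuple V) : extpow n := \pi_(extpow n) << t >>.

(* the linear map on the exterior power induced by an alternating n-linear f *)
Definition ext_lift (W : lmodType F) n (f : n.-tuple V -> W) (x : extpow n) : W :=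
  fglift f (repr x).

Definition multilinear (W : lmodType F) n (f : n.-tuple V -> W) : Prop :=
  forall t i a u v, f (tuple_set t i (a *: u + v)) =
    a *: f (tuple_set t i u) + f (tuple_set t i v).

Definition alternating (W : lmodType F) n (f : n.-tuple V -> W) : Prop :=
  forall t i j, i != j -> tnth t i = tnth t j -> f t = 0.

Lemma fglift_linear (K : choiceType) (W : lmodType F) (f : K -> W)
    (a : F) (x y : {freeg K / F}) :
  fglift f (a *: x + y) = a *: fglift f x + fglift f y.
Proof.
have addf : {morph fglift f : x y / x + y >-> x + y}.
  have subf := lift_is_additive f.
  have f0 : fglift f 0 = 0 by have := subf 0 0; rewrite !subrr.
  have fN u : fglift f (- u) = - fglift f u by rewrite -sub0r subf f0 sub0r.
  by move=> u v; rewrite -[in LHS](opprK v) subf fN opprK.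
have f0 : fglift f 0 = 0 by have := lift_is_additive f 0 0; rewrite !subrr.
rewrite addf; congr (_ + _).
have -> : a *: x = \sum_(k <- dom x) << a * coeff k x *g k >> by [].
rewrite -[in RHS](freeg_sumE x) !(big_morph _ addf f0) scaler_sumr.
by apply: eq_bigr => k _; rewrite !liftU scalerA.
Qed.

Lemma fglift1 (K : choiceType) (W : lmodType F) (f : K -> W) (k : K) :
  fglift f << k >> = f k.
Proof. by rewrite liftU scale1r. Qed.

Lemma fglift_ext_rel (W : lmodType F) n (f : n.-tuple V -> W) x y :
  multilinear f -> alternating f -> \pi_(extpow n) x = \pi_(extpow n) y ->
  fglift f x = fglift f y.
Proof.
move=> flin falt /zquot_eqP xy; rewrite -(subrK y x) -[x - y]scale1r.
rewrite fglift_linear scale1r; suff -> : fglift f (x - y) = 0 by rewrite add0r.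
have fB u v : fglift f (u - v) = fglift f u - fglift f v.
  by rewrite [u - v]addrC -[in LHS]scaleN1r fglift_linear scaleN1r addrC.
have f0 : fglift f 0 = 0 by rewrite -(subrr 0) fB !subrr.
have fZ b u : fglift f (b *: u) = b *: fglift f u.
  by rewrite -[b *: u]addr0 fglift_linear f0 addr0.
elim: xy => {x y}[//|_ [a _ [t i b u v|t i j ij tij]]|x y _ fx _ fy].
- by rewrite fZ !fB fZ !fglift1 flin [_ + f _]addrC addrK subrr scaler0.
- by rewrite fZ fglift1 (falt _ i j) ?scaler0.
- by rewrite fB fx fy subr0.
Qed.

Lemma ext_lift_ext (W : lmodType F) n (f : n.-tuple V -> W) t :
  multilinear f -> alternating f -> ext_lift f (ext t) = f t.
Proof.
move=> flin falt; rewrite -(fglift1 f t).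
by apply: fglift_ext_rel => //; rewrite reprK.
Qed.

Lemma ext_lift_linear (W : lmodType F) n (f : n.-tuple V -> W) a x y :
  multilinear f -> alternating f ->
  ext_lift f (a *: x + y) = a *: ext_lift f x + ext_lift f y.
Proof.
move=> flin falt; rewrite -fglift_linear; apply: fglift_ext_rel => //.
by rewrite lquot_pi_linear !reprK.
Qed.

Lemma ext_multilinear n : multilinear (@ext n).
Proof.
move=> t i a u v; rewrite /ext -lquot_pi_linear; apply/zquot_eqP.
apply: zspan_gen; rewrite opprD addrA -[X in scaled _ X]scale1r.
by constructor; constructor.
Qed.

Lemma ext_alternating n : alternating (@ext n).
Proof.
move=> t i j ij tij; rewrite -(raddf0 \pi_(extpow n)).
apply/zquot_eqP; rewrite subr0; apply: zspan_gen.
rewrite -[X in scaled _ X]scale1r; constructor; exact: ext_rel_alt ij tij.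
Qed.

Definition wedge m n (x : extpow m) (y : extpow n) : extpow (m + n) :=
  ext_lift (fun s => ext_lift (fun t => ext [tuple of s ++ t]) y) x.

Lemma tuple_set_catl m n (s : m.-tuple V) (t : n.-tuple V) i v :
  [tuple of tuple_set s i v ++ t] = tuple_set [tuple of s ++ t] (lshift n i) v.
Proof.
apply: eq_from_tnth => j; rewrite tnth_mktuple; case: (split_ordP j) => k ->.
  by rewrite !tnth_lshift tnth_mktuple eq_lshift.
by rewrite !tnth_rshift eq_rlshift.
Qed.

Lemma tuple_set_catr m n (s : m.-tuple V) (t : n.-tuple V) i v :
  [tuple of s ++ tuple_set t i v] = tuple_set [tuple of s ++ t] (rshift m i) v.
Proof.
apply: eq_from_tnth => j; rewrite tnth_mktuple; case: (split_ordP j) => k ->.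
  by rewrite !tnth_lshift eq_lrshift.
by rewrite !tnth_rshift tnth_mktuple eq_rshift.
Qed.

Lemma cat_multilinear m n (s : m.-tuple V) :
  multilinear (fun t : n.-tuple V => ext [tuple of s ++ t]).
Proof. by move=> t i a u v; rewrite !tuple_set_catr ext_multilinear. Qed.

Lemma cat_alternating m n (s : m.-tuple V) :
  alternating (fun t : n.-tuple V => ext [tuple of s ++ t]).
Proof.
move=> t i j ij tij.
by apply: (@ext_alternating _ _ (rshift m i) (rshift m j));
  rewrite ?eq_rshift ?tnth_rshift.
Qed.

Lemma extpow_ind n (P : extpow n -> Prop) :
  P 0 -> (forall a t x, P x -> P (a *: ext t + x)) -> forall x, P x.
Proof.
move=> P0 PS; elim/quotW => x; rewrite -[x]freeg_sumE.
elim: (dom x) => [|t r IHr]; first by rewrite big_nil raddf0.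
rewrite big_cons; suff -> : << coeff t x *g t >> = coeff t x *: << t >>.
  by rewrite lquot_pi_linear; apply: PS.
by apply/eqP/freeg_eqP=> k; rewrite coeffZ !coeffU mul1r.
Qed.

Lemma wedge_multilinear m n (y : extpow n) :
  multilinear (fun s : m.-tuple V => ext_lift (fun t => ext [tuple of s ++ t]) y).
Proof.
move=> s i a u v /=; elim/extpow_ind: y => [|b t y IHy].
  have lift0 (s' : m.-tuple V) : ext_lift (fun t : n.-tuple V => ext [tuple of s' ++ t]) 0 = 0
                  :> extpow (m + n).
    have := ext_lift_linear (-1) 0 0 (@cat_multilinear _ n s') (@cat_alternating _ n s').
    by rewrite scaler0 addr0 scaleN1r addNr.
  by rewrite !lift0 scaler0 addr0.
rewrite !(ext_lift_linear _ _ _ (@cat_multilinear _ _ _) (@cat_alternating _ _ _)).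
rewrite IHy !(ext_lift_ext _ (@cat_multilinear _ _ _) (@cat_alternating _ _ _)).
rewrite !tuple_set_catl ext_multilinear !scalerDr !scalerA mulrC.
by rewrite addrACA.
Qed.

Lemma wedge_alternating m n (y : extpow n) :
  alternating (fun s : m.-tuple V => ext_lift (fun t => ext [tuple of s ++ t]) y).
Proof.
move=> s i j ij sij /=; elim/extpow_ind: y => [|b t y IHy].
  have := ext_lift_linear (-1) 0 0 (@cat_multilinear _ n s) (@cat_alternating _ n s).
  by rewrite scaler0 addr0 scaleN1r addNr.
rewrite (ext_lift_linear _ _ _ (@cat_multilinear _ _ _) (@cat_alternating _ _ _)).
rewrite IHy (ext_lift_ext _ (@cat_multilinear _ _ _) (@cat_alternating _ _ _)).
rewrite (@ext_alternating _ _ (lshift n i) (lshift n j)) ?eq_lshift //.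
  by rewrite scaler0 addr0.
by rewrite !tnth_lshift.
Qed.

Lemma wedge_linearl m n a (x x' : extpow m) (y : extpow n) :
  wedge (a *: x + x') y = a *: wedge x y + wedge x' y.
Proof.
exact: ext_lift_linear (@wedge_multilinear _ _ _) (@wedge_alternating _ _ _).
Qed.

Lemma wedge_ext m n (s : m.-tuple V) (t : n.-tuple V) :
  wedge (ext s) (ext t) = ext [tuple of s ++ t].
Proof.
rewrite /wedge (ext_lift_ext _ (@wedge_multilinear _ _ _) (@wedge_alternating _ _ _)).
exact: ext_lift_ext (@cat_multilinear _ _ _) (@cat_alternating _ _ _).
Qed.

End ExteriorPower.

Section Slots.
Variables (F : fieldType) (V : lmodType F).

Lemma wedge_extr_scale m n (s : m.-tuple V) a (y : extpow V n) :
  wedge (ext s) (a *: y) = a *: wedge (ext s) y.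
Proof.
have wE z : wedge (ext s) z = ext_lift (fun t : n.-tuple V => ext [tuple of s ++ t]) z.
  exact: ext_lift_ext (@wedge_multilinear _ _ _ _ _) (@wedge_alternating _ _ _ _ _).
rewrite !wE.
have L := ext_lift_linear _ _ _ (@cat_multilinear _ _ _ n s) (@cat_alternating _ _ _ n s).
have lift0 := L (-1) 0 0; rewrite scaler0 addr0 scaleN1r addNr in lift0.
by rewrite -[a *: y]addr0 L lift0 addr0.
Qed.

Lemma ext_scale n (c : 'I_n -> F) (v : n.-tuple V) :
  ext [tuple c i *: tnth v i | i < n] = (\prod_(i < n) c i) *: ext v.
Proof.
pose w k := [tuple (if (i < k)%N then c i *: tnth v i else tnth v i) | i < n].
have step k : (k <= n)%N -> ext (w k) = (\prod_(i < n | (i < k)%N) c i) *: ext v.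
  elim: k => [|k IHk] kn.
    rewrite big_pred0 ?scale1r //; congr ext.
    by apply: eq_from_tnth => i; rewrite tnth_mktuple.
  pose ik := Ordinal kn.
  have -> : w k.+1 = tuple_set (w k) ik (c ik *: tnth v ik + 0).
    apply: eq_from_tnth => i; rewrite !tnth_mktuple addr0 ltnS leq_eqVlt.
    have [->|ne] := eqVneq i ik; first by rewrite eqxx.
    by rewrite -val_eqE in ne; rewrite (negbTE ne).
  have set0 : ext (tuple_set (w k) ik 0) = 0.
    have := ext_multilinear (w k) ik (-1) 0 0.
    by rewrite scaler0 addr0 scaleN1r addNr.
  rewrite ext_multilinear set0 addr0 (bigD1 ik) /= ?ltnS // -scalerA; congr (_ *: _).
  rewrite (eq_bigl (fun i : 'I_n => (i < k)%N)); last first.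
    by move=> i; rewrite ltnS ltn_neqAle andbC -val_eqE.
  rewrite -IHk ?(ltnW kn) //; congr ext; apply: eq_from_tnth => i.
  by rewrite !tnth_mktuple; case: eqP => [->|//]; rewrite ltnn.
rewrite -(eq_bigl _ _ (fun i : 'I_n => ltn_ord i)) -step //; congr ext.
by apply: eq_from_tnth => i; rewrite !tnth_mktuple ltn_ord.
Qed.

Lemma ext_cons n (t : n.-tuple V) a u v :
  ext [tuple of (a *: u + v) :: t] = a *: ext [tuple of u :: t] + ext [tuple of v :: t].
Proof.
have tsE x : [tuple of x :: t] = tuple_set [tuple of 0 :: t] ord0 x.
  apply: eq_from_tnth => i; rewrite tnth_mktuple.
  by case: (unliftP ord0 i) => [j ->|->]; rewrite ?tnthS //.
by rewrite tsE ext_multilinear -!tsE.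
Qed.

Lemma ext_cons_mem n (t : n.-tuple V) v : v \in t -> ext [tuple of v :: t] = 0.
Proof.
case/tnthP=> i ->.
pose s : n.+1.-tuple V := [tuple of tnth t i :: t].
by have := @ext_alternating F V n.+1 s ord0 (fintype.lift ord0 i); apply; rewrite ?tnthS.
Qed.

End Slots.

(* If S lists the values of an additive map on a family of additive generators
   of U, then additive_graph S is the graph of that map.  exterior_d (a db |->
   da /\ db) and artin_schreier (a dlog b |-> (a^p - a) dlog b) are given so. *)
Definition additive_graph (U V : zmodType) (S : U -> V -> Prop) (u : U) (v : V)
  : Prop :=
  zspan (fun z : U * V => S z.1 z.2) (u, v).

Definition image_of (U V : Type) (S : U -> V -> Prop) (v : V) : Prop :=
  exists u, S u v.

Lemma additive_graph0 (U V : zmodType) (S : U -> V -> Prop) : additive_graph S 0 0.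
Proof. exact: zspan0. Qed.

Lemma additive_graphB (U V : zmodType) (S : U -> V -> Prop) u v u' v' :
  additive_graph S u v -> additive_graph S u' v' -> additive_graph S (u - u') (v - v').
Proof. exact: zspanB. Qed.

Section Differentials.
Variable F : fieldType.

Inductive kahler_rel : {freeg F / F} -> Prop :=
| kahler_add x y : kahler_rel (<< x + y >> - << x >> - << y >>)
| kahler_leibniz x y :
    kahler_rel (<< x * y >> - x *: << y >> - y *: << x >>).

(* Absolute differentials, i.e. over the prime ring: derivations are additive
   with no constants imposed. *)
Definition Omega1 : Type := lquot kahler_rel.

HB.instance Definition _ := GRing.Lmodule.on Omega1.
HB.instance Definition _ := ZmodQuotient.on Omega1.

Definition diff (x : F) : Omega1 := \pi_Omega1 << x >>.
Definition dlog (x : F) : Omega1 := x^-1 *: diff x.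

Definition Omega n : Type := extpow Omega1 n.

HB.instance Definition _ n := GRing.Lmodule.on (Omega n).
HB.instance Definition _ n := ZmodQuotient.on (Omega n).

Definition diffs n (b : n.-tuple F) : Omega n := ext [tuple of map diff b].
Definition dlogs n (b : n.-tuple F) : Omega n := ext [tuple of map dlog b].

Definition nonzeros n (b : n.-tuple F) : bool := all (fun x => x != 0) b.

Inductive d_gen n : Omega n -> Omega n.+1 -> Prop :=
| DGen a (b : n.-tuple F) : d_gen (a *: diffs b) (diffs [tuple of a :: b]).

Definition exterior_d n : Omega n -> Omega n.+1 -> Prop :=
  additive_graph (@d_gen n).

(* In degree 0 there are no exact forms, Omega^(-1) being 0. *)
Definition exact n : Omega n -> Prop :=
  match n with
  | 0 => fun x => x = 0
  | m.+1 => image_of (@exterior_d m)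
  end.

Definition Omega_mod_exact n : Type := zquot (@exact n).

HB.instance Definition _ n := ZmodQuotient.on (Omega_mod_exact n).

HB.instance Definition _ n := GRing.Zmodule.on (Omega_mod_exact n).

End Differentials.

Section ExactWedge.
Variable F : fieldType.

Lemma diffD (x y : F) : diff (x + y) = diff x + diff y.
Proof.
rewrite /diff -raddfD; apply/zquot_eqP; apply: zspan_gen.
rewrite opprD addrA -[X in scaled _ X]scale1r; constructor; constructor.
Qed.

Lemma diffM (x y : F) : diff (x * y) = x *: diff y + y *: diff x.
Proof.
have -> : y *: diff x = \pi_(Omega1 F) (y *: << x >>).
  by have := lquot_pi_linear (@kahler_rel F) y << x >> 0; rewrite raddf0 !addr0.
rewrite /diff -lquot_pi_linear; apply/zquot_eqP; rewrite opprD addrA.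
have := @zspan_gen _ _ _ (Scaled 1 (kahler_leibniz x y)); rewrite scale1r.
exact.
Qed.
Lemma exact0 n : exact (0 : Omega F n).
Proof. by case: n => // n; exists 0; apply: additive_graph0. Qed.

Lemma exactB n (x y : Omega F n) : exact x -> exact y -> exact (x - y).
Proof.
case: n x y => [x y -> ->|n x y [u ux] [v vy]]; first by rewrite subr0.
by exists (u - v); apply: additive_graphB.
Qed.

Lemma zspan_exact n (x : Omega F n) : zspan (@exact F n) x <-> exact x.
Proof.
split=> [|ex]; last exact: zspan_gen.
elim=> [|//|y z _ ey _ ez]; [exact: exact0|exact: exactB].
Qed.

Lemma diff1 : diff (1 : F) = 0.
Proof.
have := diffM (1 : F) 1; rewrite mulr1 scale1r => /eqP.
by rewrite -subr_eq subrr eq_sym => /eqP.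
Qed.

Lemma diff_cons_inv n (t : n.-tuple F) c : c != 0 ->
  diffs [tuple of c :: t] = 0 -> diffs [tuple of c^-1 :: t] = 0.
Proof.
move=> c0; rewrite /diffs => hc.
have e x : [tuple of map (@diff F) [tuple of x :: t]] =
      [tuple of diff x :: [tuple of map (@diff F) t]].
  exact: val_inj.
have h : diff c^-1 = (- (c^-1 * c^-1)) *: diff c + 0.
  have := diffM c c^-1; rewrite divff // diff1 => /(congr1 ( *:%R c^-1)).
  rewrite scaler0 scalerDr !scalerA mulVf // scale1r addr0 => /esym/eqP.
  by rewrite addr_eq0 scaleNr => /eqP.
rewrite !e in hc *; rewrite h.
rewrite ext_cons hc scaler0 add0r.
have := ext_cons [tuple of map (@diff F) t] (-1) 0 0.
by rewrite scaler0 addr0 scaleN1r addNr.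
Qed.

Lemma diffs_consM n (t : n.-tuple F) x y :
  diffs [tuple of x * y :: t] = x *: diffs [tuple of y :: t] + y *: diffs [tuple of x :: t].
Proof.
have e w : [tuple of map (@diff F) [tuple of w :: t]] =
      [tuple of diff w :: [tuple of map (@diff F) t]].
  exact: val_inj.
have z : ext [tuple of 0 :: [tuple of map (@diff F) t]] = 0.
  have := ext_cons [tuple of map (@diff F) t] (-1) 0 0.
  by rewrite scaler0 addr0 scaleN1r addNr.
by rewrite /diffs !e diffM ext_cons -[y *: diff x]addr0 ext_cons z addr0.
Qed.

Lemma exact_wedge_dlogs i m (x : Omega F i) (g : m.-tuple F) :
  nonzeros g -> exact x -> exact (wedge x (dlogs g)).
Proof.
move=> nzg.
have w0 n : wedge (0 : Omega F n) (dlogs g) = 0.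
  by have := wedge_linearl (-1) (0 : Omega F n) 0 (dlogs g); rewrite scaler0 addr0 scaleN1r addNr.
have wB n (u v : Omega F n) : wedge (u - v) (dlogs g) = wedge u (dlogs g) - wedge v (dlogs g).
  by rewrite addrC -scaleN1r wedge_linearl scaleN1r addrC.
case: i x => [x ->|i x [w]].
  by rewrite w0; apply: exact0.
suff H z : zspan (fun z => d_gen z.1 z.2) z -> @exact F (i.+1 + m) (wedge z.2 (dlogs g)) by move/H.
elim=> {w z} [|[u v] /= [a b]|y z _ hy _ hz]; last 1 first.
- have -> : (y - z).2 = y.2 - z.2 by [].
  by rewrite wB; apply: (@exactB (i.+1 + m)).
- by rewrite w0; apply: (@exact0 (i.+1 + m)).
pose c := \prod_(j < m) (tnth g j)^-1.
have -> : dlogs g = c *: diffs g.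
  rewrite /dlogs /diffs -ext_scale; congr ext; apply: eq_from_tnth => j.
  by rewrite tnth_mktuple !tnth_map.
rewrite wedge_extr_scale wedge_ext.
pose t := [tuple of b ++ g].
have -> : ext [tuple of [tuple of map (@diff F) [tuple of a :: b]] ++ [tuple of map (@diff F) g]]
   = diffs [tuple of a :: t] :> Omega F (i + m).+1.
  by congr ext; apply: val_inj; rewrite /= map_cat.
have c0 : diffs [tuple of c :: t] = 0.
  have e w : [tuple of map (@diff F) [tuple of w :: t]] =
      [tuple of diff w :: [tuple of map (@diff F) t]].
    exact: val_inj.
  rewrite /c; elim/big_ind: _ => [|c1 c2 hx hy|j _].
  - rewrite /diffs e diff1.
    have := ext_cons [tuple of map (@diff F) t] (-1) 0 0.
    by rewrite scaler0 addr0 scaleN1r addNr.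
  - by rewrite diffs_consM hx hy !scaler0 addr0.
  - apply: diff_cons_inv; first by apply: (allP nzg); apply: mem_tnth.
    rewrite /diffs e; apply: ext_cons_mem; apply: map_f.
    by rewrite mem_cat mem_tnth orbT.
have -> : c *: diffs [tuple of a :: t] = diffs [tuple of c * a :: t] :> Omega F (i + m).+1.
  by rewrite diffs_consM c0 scaler0 addr0.
by exists ((c * a) *: diffs t); apply: zspan_gen => /=; constructor.
Qed.

End ExactWedge.

Section KatoMilne.
Variables (F : fieldType) (p : nat).

Inductive AS_gen n : Omega F n -> Omega_mod_exact F n -> Prop :=
| ASGen a (b : n.-tuple F) : nonzeros b ->
    AS_gen (a *: dlogs b) (\pi_(Omega_mod_exact F n) ((a ^+ p - a) *: dlogs b)).

Definition artin_schreier n : Omega F n -> Omega_mod_exact F n -> Prop :=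
  additive_graph (@AS_gen n).

(* KM n is H_p^(n+1)(F), the cokernel of the Artin-Schreier map.  For n = 0 it
   is F / wp(F), since Omega F 0 is the line F spanned by the empty wedge. *)
Definition KM n : Type := zquot (image_of (@artin_schreier n)).

HB.instance Definition _ n := ZmodQuotient.on (KM n).
HB.instance Definition _ n := GRing.Zmodule.on (KM n).

Definition nu n (x : Omega F n) : Prop := artin_schreier x 0.

Definition km_class n (x : Omega F n) : KM n :=
  \pi_(KM n) (\pi_(Omega_mod_exact F n) x).

(* the symbol a dlog b_1 /\ ... /\ dlog b_n in H_p^(n+1)(F) *)
Definition symbol n (a : F) (b : n.-tuple F) : KM n := km_class (a *: dlogs b).

(* The product H_p^(i+1)(F) x nu_F(m) -> H_p^(i+1+m)(F).  A representative of x
   is chosen; by cup_class below the choice is immaterial for symbols y. *)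
Definition cup i m (x : KM i) (y : Omega F m) : KM (i + m) :=
  km_class (wedge (repr (repr x)) y).

Lemma cup_class i m (x : Omega F i) (g : m.-tuple F) : nonzeros g ->
  cup (km_class x) (dlogs g) = km_class (wedge x (dlogs g)).
Proof.
move=> nzg; rewrite /cup.
pose phi n (x : Omega F n) := km_class (wedge x (dlogs g)).
have phiB n (u v : Omega F n) : phi n (u - v) = phi n u - phi n v.
  by rewrite /phi addrC -scaleN1r wedge_linearl scaleN1r addrC /km_class !raddfB.
have phi_exact n (u : Omega F n) : zspan (@exact F n) u -> phi n u = 0.
  move/zspan_exact/(exact_wedge_dlogs nzg) => h.
  rewrite /phi /km_class; suff -> : \pi_(Omega_mod_exact F (n + m)) (wedge u (dlogs g)) = 0 by rewrite raddf0.
  by rewrite -(raddf0 \pi_(Omega_mod_exact F (n + m))); apply/zquot_eqP; rewrite subr0; apply: zspan_gen.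
have phi_pi n (u v : Omega F n) : \pi_(Omega_mod_exact F n) u = \pi v -> phi n u = phi n v.
  by move/zquot_eqP/phi_exact; rewrite phiB => /eqP; rewrite subr_eq0 => /eqP.
suff H n (u v : Omega_mod_exact F n) : \pi_(KM n) u = \pi_(KM n) v -> phi n (repr u) = phi n (repr v).
  rewrite -[RHS](phi_pi _ (repr (\pi_(Omega_mod_exact F i) x))); last by rewrite reprK.
  by apply: H; rewrite reprK.
move/zquot_eqP=> h; apply/eqP; rewrite -subr_eq0 -phiB; apply/eqP.
have -> : phi n (repr u - repr v) = phi n (repr (u - v)).
  by apply: phi_pi; rewrite raddfB /= !reprK.
elim: h => [|{}u [w]|{}u {}v _ hu _ hv].
- by rewrite (phi_pi _ _ 0) ?reprK ?raddf0 //; have := phiB n 0 0; rewrite !subrr.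
- suff H z : zspan (fun z => @AS_gen n z.1 z.2) z -> phi n (repr z.2) = 0 by move/H.
  elim=> {u w z} [|[w1 v1] /= [a b nzb]|y z _ hy _ hz] /=.
  + by rewrite (phi_pi _ _ 0) ?reprK ?raddf0 //; have := phiB n 0 0; rewrite !subrr.
  + rewrite (phi_pi _ _ ((a ^+ p - a) *: dlogs b)) ?reprK // /phi.
    have -> : wedge ((a ^+ p - a) *: dlogs b) (dlogs g) = (a ^+ p - a) *: dlogs [tuple of b ++ g].
      have := wedge_linearl (a ^+ p - a) (dlogs b) 0 (dlogs g).
      have -> : wedge (0 : Omega F n) (dlogs g) = 0.
        by have := wedge_linearl (-1) (0 : Omega F n) 0 (dlogs g); rewrite scaler0 addr0 scaleN1r addNr.
      rewrite !addr0 => ->; rewrite wedge_ext; congr (_ *: ext _).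
      by apply: val_inj; rewrite /= map_cat.
    rewrite /km_class -(raddf0 \pi_(KM (n + m))); apply/zquot_eqP; rewrite subr0.
    apply: zspan_gen; exists (a *: dlogs [tuple of b ++ g]); apply: zspan_gen.
    by constructor; rewrite /nonzeros all_cat; apply/andP.
  + have -> : phi n (repr (y.2 - z.2)) = phi n (repr y.2 - repr z.2).
      by apply: phi_pi; rewrite raddfB /= !reprK.
    by rewrite phiB hy hz subr0.
- have -> : phi n (repr (u - v)) = phi n (repr u - repr v).
    by apply: phi_pi; rewrite raddfB /= !reprK.
  by rewrite phiB hu hv subr0.
Qed.

(* theta in H_p^(i+1)(F) is a factor of the symbol pi in H_p^(i+1+m)(F) *)
Definition is_factor i m (theta : KM i) (pi : KM (i + m)) : Prop :=
  (exists a (b : i.-tuple F), nonzeros b /\ theta = symbol a b) /\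
  (exists c : m.-tuple F, nonzeros c /\ pi = cup theta (dlogs c)).

(* total separable (i+1)-linkage *)
Definition totally_separably_linked i m (pi omega : KM (i + m)) : Prop :=
  forall theta : KM i, is_factor theta pi <-> is_factor theta omega.

Lemma dlogs_nu n (b : n.-tuple F) : nonzeros b -> nu (dlogs b).
Proof.
move=> nzb; have := @ASGen n 1 b nzb.
by rewrite expr1n subrr scale0r scale1r raddf0 => ?; apply: zspan_gen.
Qed.

End KatoMilne.

(* Main.v *)
Require Import Defs.
From mathcomp Require Import all_boot all_algebra all_fingroup.

(** The proof exhibits two factors of pi whose comparison recovers beta.

    Two identities in H_p drive it: a dlog a = da, so that a symbol with
    coefficient a and an entry a vanishes ([symbol_diag]); and dlog turns
    products into sums, so that a symbol is additive in its last entry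
    ([symbol_rconsM]).  Write {a | t, x} for the class of
    a dlog t_1 /\ ... /\ dlog t_n /\ dlog x.  Then
<<
      {a | t, b} = {a | t, ab} = {a + ab | t, ab},
>>
    the first step adding the vanishing symbol {a | t, a}, the second adding
    the vanishing symbol {ab | t, ab}.  Hence the class of a(1 + b) in H_p^1 is
    a factor of {a | t, b} ([factor_addM]); and since
    {a | t, b} = - {a | t, b^-1}, so is that of a(1 + b^-1) ([factor_addV]).

    Conversely, if the class of e is a factor of a symbol omega, say
    omega = e dlog c_1 /\ ... /\ dlog c_m, then omega /\ dlog e vanishes,
    again because of the coefficient e next to the entry e
    ([symbol_rcons_factor]).

    Total linkage makes alpha(1 + beta) and alpha(1 + beta^-1) factors of omega,
    so omega /\ dlog kills both; their quotient being beta, it follows that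
    omega /\ dlog beta = 0, which is the claim up to the order of the last two
    entries.  The argument needs alpha and 1 + beta to be nonzero; otherwise the
    claim is immediate, as dlog (-1) = 0. *)

Set Implicit Arguments.
Unset Strict Implicit.
Unset Printing Implicit Defensive.

Import GRing.Theory.
Local Open Scope ring_scope.

(** * Permuting the entries of an exterior product *)

Section ExteriorAlgebra.
Context (F : fieldType) (V : lmodType F).

Lemma multilinearD (W : lmodType F) n (f : n.-tuple V -> W) t i u v :
  multilinear f ->
  f (tuple_set t i (u + v)) = f (tuple_set t i u) + f (tuple_set t i v).
Proof. by move=> fM; rewrite -{1}(scale1r u) fM scale1r. Qed.

Lemma ext_cons0 n (t : n.-tuple V) : ext [tuple of 0 :: t] = 0.
Proof.
by have := ext_cons t (-1) 0 0; rewrite scaler0 addr0 scaleN1r addNr.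
Qed.

Lemma wedge0l m n (y : extpow V n) : wedge (0 : extpow V m) y = 0.
Proof.
have := wedge_linearl (-1) (0 : extpow V m) 0 y.
by rewrite scaler0 addr0 scaleN1r addNr.
Qed.

(** Polarization: expand the vanishing product with the sum of entries i and j
    in both places. *)
Lemma ext_tperm n (t : n.-tuple V) (i j : 'I_n) : i != j ->
  ext [tuple tnth t (tperm i j k) | k < n] = - ext t.
Proof.
move=> ij.
(* t with u in place i and v in place j *)
pose w u v := tuple_set (tuple_set t i u) j v.
have wC u v : w u v = tuple_set (tuple_set t j v) i u.
  apply: eq_from_tnth => k; rewrite !tnth_mktuple.
  by have [->|] := eqVneq k j; rewrite // eq_sym (negbTE ij).
have w0 u : ext (w u u) = 0.
  by apply: (@ext_alternating _ _ _ _ i j); rewrite // !tnth_mktuple !eqxx (negbTE ij).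
have wDl u u' v : ext (w (u + u') v) = ext (w u v) + ext (w u' v).
  by rewrite !wC multilinearD //; exact: ext_multilinear.
have wDr u v v' : ext (w u (v + v')) = ext (w u v) + ext (w u v').
  by rewrite /w multilinearD //; exact: ext_multilinear.
have := w0 (tnth t i + tnth t j).
rewrite wDl !wDr !w0 add0r addr0.
have -> : w (tnth t i) (tnth t j) = t.
  apply: eq_from_tnth => k; rewrite !tnth_mktuple.
  by case: eqVneq => [->|_]; last case: eqVneq => [->|].
have -> : w (tnth t j) (tnth t i) = [tuple tnth t (tperm i j k) | k < n].
  apply: eq_from_tnth => k; rewrite !tnth_mktuple.
  have [->|kj] := eqVneq k j; first by rewrite tpermR.
  have [->|ki] := eqVneq k i; first by rewrite tpermL.
  by rewrite tpermD // eq_sym.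
by move/eqP; rewrite addrC addr_eq0 => /eqP.
Qed.

Lemma ext_perm n (s : 'S_n) (t : n.-tuple V) :
  ext [tuple tnth t (s k) | k < n] = (-1) ^+ odd_perm s *: ext t.
Proof.
have [ts -> dts] := prod_tpermP s.
elim: ts dts t => [_|[i j] ts IHts /= /andP[ij dts]] t.
  rewrite big_nil odd_perm1 scale1r; congr ext.
  by apply: eq_from_tnth => k; rewrite tnth_mktuple perm1.
rewrite big_cons odd_mul_tperm ij addTb signrN scaleNr.
rewrite -IHts // -(ext_tperm _ ij); congr ext.
by apply: eq_from_tnth => k; rewrite !tnth_mktuple permM.
Qed.

Lemma ext_perm_eq n (s t : n.-tuple V) : perm_eq s t ->
  exists b : bool, ext s = (-1) ^+ b *: ext t.
Proof.
case/tuple_permP => q sE; exists (odd_perm q); rewrite -ext_perm.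
by congr ext; apply: val_inj.
Qed.

End ExteriorAlgebra.

(** * Calculus of symbols *)

Section Symbols.
Context (F : fieldType) (p : nat).

Lemma km_classD n (x y : Omega F n) :
  km_class p (x + y) = km_class p x + km_class p y.
Proof. by rewrite /km_class !raddfD. Qed.

Lemma km_classN n (x : Omega F n) : km_class p (- x) = - km_class p x.
Proof. by rewrite /km_class !raddfN. Qed.

Lemma km_class0 n : km_class p (0 : Omega F n) = 0.
Proof. by rewrite /km_class !raddf0. Qed.

Lemma km_class_exact n (x : Omega F n) : exact x -> km_class p x = 0.
Proof.
move=> ex; rewrite -(km_class0 n) /km_class; congr (\pi_(KM F p n) _)%qT.
by apply/zquot_eqP; rewrite subr0; apply: zspan_gen.
Qed.

Lemma dlogM (x y : F) : x != 0 -> y != 0 -> dlog (x * y) = dlog x + dlog y.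
Proof.
move=> x0 y0; rewrite /dlog diffM scalerDr !scalerA invfM mulrAC mulVf // mul1r.
by rewrite addrC -mulrA mulVf // mulr1.
Qed.

Lemma dlogN1 : dlog (-1 : F) = 0.
Proof.
have d0 : diff (0 : F) = 0 by apply: (addrI (diff 0)); rewrite -diffD !addr0.
have := diffD (1 : F) (-1); rewrite subrr d0 diff1 add0r => h.
by rewrite /dlog -h scaler0.
Qed.

Lemma symbolDl n a b (t : n.-tuple F) :
  symbol p (a + b) t = symbol p a t + symbol p b t.
Proof. by rewrite /symbol scalerDl km_classD. Qed.

Lemma symbol0 n (t : n.-tuple F) : symbol p 0 t = 0.
Proof. by rewrite /symbol scale0r km_class0. Qed.

Lemma symbol_perm n a (s t : n.-tuple F) :
  perm_eq s t -> symbol p a s = 0 -> symbol p a t = 0.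
Proof.
move=> /(perm_map (@dlog F)) st.
have [b] := @ext_perm_eq F _ n [tuple of map (@dlog F) s] [tuple of map (@dlog F) t] st.
rewrite /symbol /dlogs => ->; case: b; rewrite ?scale1r // scaleN1r scalerN km_classN.
by move/eqP; rewrite oppr_eq0 => /eqP.
Qed.

(** Transports the vanishing of a symbol between degrees that are equal but not
    convertible, such as n + 1 and n.+1. *)
Lemma symbol_eq0_val m n a (s : m.-tuple F) (t : n.-tuple F) :
  s = t :> seq F -> symbol p a s = 0 -> symbol p a t = 0.
Proof.
move=> st; have mn : m = n by rewrite -(size_tuple s) st size_tuple.
by case: n / mn t st => t /val_inj ->.
Qed.

Lemma dlogs_consE n (t : n.-tuple F) x :
  dlogs [tuple of x :: t] = ext [tuple of dlog x :: [tuple of map (@dlog F) t]].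
Proof. by congr ext; apply: val_inj. Qed.

Lemma dlogs_rconsM n (t : n.-tuple F) x y : x != 0 -> y != 0 ->
  dlogs [tuple of rcons t (x * y)] =
  dlogs [tuple of rcons t x] + dlogs [tuple of rcons t y].
Proof.
(* The entry 0 is a placeholder: only the last place of r gets overwritten. *)
move=> x0 y0; pose r : n.+1.-tuple (Omega1 F) := [tuple of map (@dlog F) [tuple of rcons t 0]].
have rE z : dlogs [tuple of rcons t z] = ext (tuple_set r ord_max (dlog z)).
  congr ext; apply: eq_from_tnth => i; rewrite tnth_mktuple tnth_map.
  rewrite /r tnth_map !(tnth_nth 0) /= !nth_rcons size_tuple.
  have [->|ne] := eqVneq i ord_max; first by rewrite /= ltnn eqxx.
  suff -> : (i < n)%N by [].
  by rewrite ltn_neqAle -ltnS ltn_ord andbT; exact: ne.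
by rewrite !rE dlogM // multilinearD //; exact: ext_multilinear.
Qed.

Lemma symbol_rconsM n a (t : n.-tuple F) x y : x != 0 -> y != 0 ->
  symbol p a [tuple of rcons t (x * y)] =
  symbol p a [tuple of rcons t x] + symbol p a [tuple of rcons t y].
Proof. by move=> x0 y0; rewrite /symbol dlogs_rconsM // scalerDr km_classD. Qed.

Lemma symbol_rconsV n a (t : n.-tuple F) x : x != 0 ->
  symbol p a [tuple of rcons t x^-1] = - symbol p a [tuple of rcons t x].
Proof.
move=> x0; have s1 : symbol p a [tuple of rcons t 1] = 0.
  apply: (addrI (symbol p a [tuple of rcons t 1])).
  by rewrite addr0 -symbol_rconsM ?oner_neq0 // mulr1.
apply/eqP; rewrite -addr_eq0 -symbol_rconsM ?invr_eq0 // mulVf //.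
by apply/eqP.
Qed.

Lemma symbol_rconsN1 n a (t : n.-tuple F) :
  symbol p a [tuple of rcons t (-1)] = 0.
Proof.
apply: (@symbol_perm _ _ [tuple of (-1) :: t]); first by rewrite perm_sym perm_rcons.
by rewrite /symbol dlogs_consE dlogN1 ext_cons0 scaler0 km_class0.
Qed.

(** a dlog a = da, and the product of an exact form with logarithmic forms is
    exact. *)
Lemma symbol_diag n a (t : n.-tuple F) : nonzeros t ->
  symbol p a [tuple of rcons t a] = 0.
Proof.
have [->|a0] := eqVneq a 0; first by rewrite symbol0.
move=> nzt; apply: (@symbol_perm _ _ [tuple of a :: t]).
  by rewrite perm_sym perm_rcons.
have ex1 : exact (diffs [tuple a] : Omega F 1).
  exists (a *: diffs [tuple]); apply: zspan_gen.
  have -> : [tuple a] = [tuple of a :: [tuple]] by apply: val_inj.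
  exact: DGen.
rewrite /symbol; suff -> : a *: dlogs [tuple of a :: t] = wedge (diffs [tuple a]) (dlogs t).
  by apply: (@km_class_exact (1 + n)); apply: exact_wedge_dlogs.
rewrite dlogs_consE wedge_ext.
rewrite /dlog -[_^-1 *: diff a]addr0 ext_cons ext_cons0 addr0 scalerA divff // scale1r.
by congr ext; apply: val_inj.
Qed.

(** * Factors in H_p^1 *)

Lemma cup_symbol m n a (s : m.-tuple F) (t : n.-tuple F) : nonzeros t ->
  cup (symbol p a s) (dlogs t) = symbol p a [tuple of s ++ t].
Proof.
move=> nzt; rewrite /symbol cup_class //; congr km_class.
rewrite -[a *: dlogs s]addr0 wedge_linearl wedge0l addr0 wedge_ext.
by congr (_ *: ext _); apply: val_inj; rewrite /= map_cat.
Qed.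

Lemma cup_symbol_nil n a (t : n.-tuple F) : nonzeros t ->
  cup (symbol p a [tuple]) (dlogs t) = symbol p a t.
Proof.
move=> nzt; rewrite cup_symbol //; congr symbol.
exact: val_inj.
Qed.

(** Writing the symbol as b dlog c_1 /\ ... /\ dlog c_n, its product with dlog b
    has the coefficient b next to the entry b. *)
Lemma symbol_rcons_factor n a b (s : n.-tuple F) : b != 0 ->
  @is_factor F p 0 n (symbol p b [tuple]) (symbol p a s) ->
  symbol p a [tuple of rcons s b] = 0.
Proof.
move=> b0 [_ [c [nzc]]]; rewrite cup_symbol_nil // => sE.
have nzb : nonzeros [tuple b] by rewrite /nonzeros /= b0.
apply: (@symbol_eq0_val _ _ _ [tuple of s ++ [tuple b]]).
  by rewrite /= cats1.
rewrite -cup_symbol // sE cup_symbol //.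
apply: (@symbol_eq0_val _ _ _ [tuple of rcons c b]); first by rewrite /= cats1.
exact: symbol_diag.
Qed.

Lemma symbol_factor n a b (t : n.-tuple F) : nonzeros t ->
  symbol p a t = symbol p b t ->
  @is_factor F p 0 n (symbol p b [tuple]) (symbol p a t).
Proof.
move=> nzt E; split; first by exists b, [tuple].
by exists t; rewrite cup_symbol_nil.
Qed.

Lemma nonzeros_rcons n (t : n.-tuple F) x :
  nonzeros t -> x != 0 -> nonzeros [tuple of rcons t x].
Proof. by move=> nzt x0; rewrite /nonzeros /= all_rcons x0. Qed.

(** Both symbols that are added on the way, with coefficient and last entry a,
    and with coefficient and last entry a * b, vanish. *)
Lemma symbol_addM n a b (t : n.-tuple F) : nonzeros t -> a != 0 -> b != 0 ->
  symbol p a [tuple of rcons t b] =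
  symbol p (a * (1 + b)) [tuple of rcons t (a * b)].
Proof.
move=> nzt a0 b0; rewrite mulrDr mulr1 symbolDl symbol_diag // addr0.
by rewrite symbol_rconsM // symbol_diag // add0r.
Qed.

Lemma factor_addM n a b (t : n.-tuple F) : nonzeros t -> a != 0 -> b != 0 ->
  @is_factor F p 0 n.+1 (symbol p (a * (1 + b)) [tuple])
    (symbol p a [tuple of rcons t b]).
Proof.
move=> nzt a0 b0; rewrite symbol_addM //.
by apply: symbol_factor => //; apply: nonzeros_rcons; rewrite ?mulf_neq0.
Qed.

(** Obtained from b^-1: inverting the last entry only changes the sign of a
    symbol, which inverting the entry a * b^-1 undoes. *)
Lemma factor_addV n a b (t : n.-tuple F) : nonzeros t -> a != 0 -> b != 0 ->
  @is_factor F p 0 n.+1 (symbol p (a * (1 + b^-1)) [tuple])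
    (symbol p a [tuple of rcons t b]).
Proof.
move=> nzt a0 b0; have bV0 : b^-1 != 0 by rewrite invr_eq0.
have -> : symbol p a [tuple of rcons t b] =
    symbol p (a * (1 + b^-1)) [tuple of rcons t (a * b^-1)^-1].
  by rewrite symbol_rconsV ?mulf_neq0 // -symbol_addM // symbol_rconsV // opprK.
by apply: symbol_factor => //; apply: nonzeros_rcons; rewrite ?invr_eq0 ?mulf_neq0.
Qed.

End Symbols.

Theorem corollary3p3 (F : fieldType) (p : nat) (charF : p \in [pchar F])
  (n : nat) (n_ge2 : (2 <= n)%N)
  (alpha beta gamma : F) (delta : (n - 2).-tuple F)
  (beta_neq0 : beta != 0) (gamma_neq0 : gamma != 0)
  (delta_neq0 : nonzeros delta) :
  @totally_separably_linked F p 0 (n - 2).+1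
    (symbol p alpha [tuple of rcons delta beta])
    (symbol p alpha [tuple of rcons delta gamma]) ->
  symbol p alpha [tuple of rcons (rcons delta beta) gamma] = 0.
Proof.
move=> link.
have [->|alpha0] := eqVneq alpha 0; first by rewrite symbol0.
apply: (@symbol_perm _ _ _ _ [tuple of rcons (rcons delta gamma) beta]).
  by rewrite /= -!cats1 -!catA perm_cat2l perm_catC.
have [->|betaN1] := eqVneq beta (-1); first exact: symbol_rconsN1.
have beta1 : 1 + beta != 0 by rewrite addrC addr_eq0.
have betaV1 : 1 + beta^-1 != 0.
  by rewrite -[1](mulfV beta_neq0) -{2}[beta^-1]mul1r -mulrDl addrC mulf_neq0 ?invr_eq0.
have /(_ (mulf_neq0 alpha0 beta1)) :=
  symbol_rcons_factor _ ((link _).1 (factor_addM _ delta_neq0 alpha0 beta_neq0)).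
have betaE : alpha * (1 + beta) = alpha * (1 + beta^-1) * beta.
  by rewrite -mulrA [(1 + _) * _]mulrDl mul1r mulVf // [beta + 1]addrC.
rewrite betaE symbol_rconsM ?mulf_neq0 //.
rewrite symbol_rcons_factor ?mulf_neq0 ?add0r //.
by apply/link/factor_addV.
Qed.
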